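(* Let $\lambda\in\mathbb{R}$ be a Wilton–Cremer number. The function $\varphi_2$ is not differentiable at $\lambda$.
   Context: $\{t\}$ is the fractional part of $t$. $B_2(t)=\{t\}^2-\{t\}+\frac16$, and $\varphi_2(\lambda)=\sum_{n\ge1}B_2(n\lambda)/n^2$ for $\lambda\in\mathbb{R}$ (a $1$-periodic function). For $x\in X=(0,1)\setminus\mathbb{Q}$ put $\alpha(x)=\{1/x\}$, $\alpha_0(x)=x$, $\alpha_k(x)=\alpha(\alpha_{k-1}(x))$ for $k\ge1$, $\beta_{-1}=1$, $\beta_k(x)=\alpha_0(x)\cdots\alpha_k(x)$, $\gamma_k(x)=\beta_{k-1}(x)\log(1/\alpha_k(x))$, and consider the series $\mathcal{W}(x)=\sum_{k\ge0}(-1)^k\gamma_k(x)$, extended to all irrational real $x$ by $\mathcal{W}(x)=\mathcal{W}(\{x\})$. An irrational real number $x$ is a Wilton–Cremer number if the series $\mathcal{W}(x)$ diverges (i.e. does not converge). *)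

(* Defs.v *)
From Stdlib Require Import Reals QArith Qreals.
From Coquelicot Require Import Coquelicot.
Open Scope R_scope.

Definition B2 (t : R) : R := (frac_part t) ^ 2 - frac_part t + 1 / 6.

(* [Series] starts at index 0, so its [k]-th term is the one for n = k + 1. *)
Definition phi2 (lambda : R) : R :=
  Series (fun k : nat => B2 (INR (S k) * lambda) / (INR (S k)) ^ 2).

Definition irrational (x : R) : Prop := forall q : Q, x <> Q2R q.

Definition alpha (x : R) : R := frac_part (/ x).

Fixpoint alpha_iter (k : nat) (x : R) : R :=
  match k with
  | O => x
  | S j => alpha (alpha_iter j x)
  end.

(* beta_pred k x is beta_{k-1}(x): the index is shifted by one so that
   beta_{-1} = 1 is the value at k = 0. *)
Fixpoint beta_pred (k : nat) (x : R) : R :=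
  match k with
  | O => 1
  | S j => beta_pred j x * alpha_iter j x
  end.

Definition gamma (k : nat) (x : R) : R :=
  beta_pred k x * ln (/ alpha_iter k x).

(* The functions above are meant on (0,1) minus Q; for a general irrational x
   the series is the one attached to the fractional part of x. *)
Definition wilton_term (x : R) (k : nat) : R :=
  (-1) ^ k * gamma k (frac_part x).

(* [ex_series] is convergence to a finite real, so its negation covers every
   kind of divergence, including to an infinite limit. *)
Definition wilton_cremer (x : R) : Prop :=
  irrational x /\ ~ ex_series (wilton_term x).

(* Main.v *)
Require Import Defs.
From Stdlib Require Import Reals ZArith QArith Qreals Lia Lra.
From Coquelicot Require Import Coquelicot.
Open Scope R_scope.

(** Write [phi] for [phi2] and [slope f x y] for [(f y - f x) / (y - x)].

    Formally the derivative of [phi] is twice the sum of [({n x} - 1/2) / n],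
    which transforms under the Gauss map like a modular object of weight one,
    up to a cocycle whose only singular part is a logarithm.  Integrated once,
    this becomes a statement about [phi] alone that needs no convergence of the
    derived series ([phi2_reciprocity]): on [(0,1)],

      [phi x - x^3 phi (1/x) = x ln x + quadratic polynomial + Phi x],

    where [Phi] is Lipschitz and differentiable.  It comes from summing
    [B2 (n x) / n^2] over [n] and [B2 (m / x) / m^2] over [m] simultaneously by
    Euler-Maclaurin in a variable [t], the first sum at [t = n], the second at
    [t = m / x]: in the difference of the two the product of the two sawtooth
    functions cancels, and a kernel of size [t^-3] against [B2 (t x)] remains.

    Taking slopes of this identity ([slope_error_control]),

      [slope phi x y + x * slope phi (1/x) (1/y) = ln x + error],

    where the error is bounded as long as [1/x] and [1/y] are at distance at
    most one, and has a limit when [y] tends to [x].  As [phi] is 1-periodic,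
    this can be iterated along the continued fraction of [x].  The second point
    is chosen so that the iteration ends exactly: writing [x] as the continued
    fraction [1/(a_1 + 1/(... + 1/(a_m + alpha_m(x))))], [companion m x] has
    [alpha_m(x) + 1] in place of [alpha_m(x)], and the slope of a 1-periodic
    function between these two numbers vanishes.  Thus
    ([slope_companion_sum]) [slope phi x (companion m x)] is exactly the sum
    over [k < m] of [(-1)^k beta_{k-1} (ln alpha_k + error)].

    Finally [companion m x] tends to [x].  If [phi] is differentiable at [x]
    the slopes converge, and the sum of the errors converges by dominated
    convergence, because [beta_{k-1}] decays geometrically.  Hence the Wilton
    series converges at every irrational point of differentiability. *)

(** * The Bernoulli function B_2 *)

Lemma frac_part_bounds (t : R) : 0 <= frac_part t < 1.
Proof. destruct (base_fp t); lra. Qed.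

Lemma frac_part_cell (z : Z) (t : R) :
  IZR z <= t < IZR z + 1 -> frac_part t = t - IZR z.
Proof.
  intros H. unfold frac_part.
  rewrite <- (Int_part_spec t z); lra.
Qed.

Lemma frac_part_add_IZR (z : Z) (t : R) : frac_part (t + IZR z) = frac_part t.
Proof.
  pose proof (frac_part_bounds t) as H.
  rewrite (frac_part_cell (Int_part t + z)); rewrite plus_IZR; unfold frac_part in *; lra.
Qed.

Lemma B2_add_IZR (z : Z) (t : R) : B2 (t + IZR z) = B2 t.
Proof. unfold B2. now rewrite frac_part_add_IZR. Qed.

(** The polynomial formula holds on the closed cell because the polynomial takes
    the same value at 0 and 1; it is what makes piecewise computations with [B2]
    match at the integers. *)
Lemma B2_cell (z : Z) (t : R) :
  IZR z <= t <= IZR z + 1 -> B2 t = (t - IZR z) ^ 2 - (t - IZR z) + 1 / 6.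
Proof.
  intros H. unfold B2.
  destruct (Req_dec t (IZR z + 1)) as [->|Hne].
  - rewrite (frac_part_cell (z + 1)); rewrite plus_IZR; [ring|lra].
  - rewrite (frac_part_cell z); [ring|lra].
Qed.

Lemma B2_bound (t : R) : Rabs (B2 t) <= 1 / 6.
Proof.
  unfold B2. pose proof (frac_part_bounds t).
  apply Rabs_le. split; nra.
Qed.

Lemma cell_exists (t : R) : exists z : Z, IZR z <= t < IZR z + 1.
Proof. exists (Int_part t). pose proof (base_Int_part t). lra. Qed.

(** The derivative [2 {t} - 1] is at most one in absolute value; points at distance at least one
    are covered by the bound on [B2], closer points lie in at most two
    consecutive cells. *)
Lemma B2_lipschitz (s t : R) : Rabs (B2 t - B2 s) <= Rabs (t - s).
Proof.
  assert (W : forall s t, s <= t -> Rabs (B2 t - B2 s) <= t - s).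
  { clear. intros s t Hst.
    destruct (cell_exists s) as [z Hz].
    destruct (Rle_lt_dec t (IZR z + 1)) as [Ht|Ht].
    - rewrite (B2_cell z s), (B2_cell z t) by lra. apply Rabs_le. split; nra.
    - destruct (Rle_lt_dec 1 (t - s)) as [H1|H1].
      + pose proof (B2_bound s) as Hs. pose proof (B2_bound t) as Ht'.
        apply Rabs_le_between in Hs. apply Rabs_le_between in Ht'.
        apply Rabs_le. lra.
      + rewrite (B2_cell z s) by lra.
        rewrite (B2_cell (z + 1) t) by (rewrite plus_IZR; lra).
        rewrite plus_IZR. apply Rabs_le. split; nra. }
  destruct (Rle_lt_dec s t) as [H|H].
  - rewrite (Rabs_pos_eq (t - s)) by lra. now apply W.
  - rewrite Rabs_minus_sym, (Rabs_minus_sym t s), (Rabs_pos_eq (s - t)) by lra.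
    apply W; lra.
Qed.

Lemma B2_continuous (t : R) : continuous B2 t.
Proof.
  apply continuity_pt_filterlim. intros eps Heps. exists eps. split; [exact Heps|].
  intros s [_ Hs]. simpl in *. unfold R_dist in *.
  eapply Rle_lt_trans; [apply B2_lipschitz|exact Hs].
Qed.

(** * Dominated convergence for series *)

Lemma ex_series_dominated (u b : nat -> R) :
  (forall k, Rabs (u k) <= b k) -> ex_series b -> ex_series u.
Proof.
  intros H. apply (@ex_series_le R_AbsRing R_CompleteNormedModule u b). exact H.
Qed.

(** Tannery's theorem.  It carries every passage to the limit below: the continuity
    of [phi2], the differentiation of [Phi], and the convergence of the error
    terms along the continued fraction. *)
Lemma tannery (a : nat -> nat -> R) (l b : nat -> R) :
  (forall k, is_lim_seq (fun m => a m k) (l k)) ->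
  (forall m k, Rabs (a m k) <= b k) -> ex_series b ->
  is_lim_seq (fun m => Series (a m)) (Series l).
Proof.
  intros Hl Hb Exb.
  assert (Hlb : forall k, Rabs (l k) <= b k).
  { intros k.
    apply (is_lim_seq_le (fun m => Rabs (a m k)) (fun _ => b k) (Rabs (l k)) (b k)).
    - intros m; apply Hb.
    - apply (is_lim_seq_abs _ (l k)), Hl.
    - apply is_lim_seq_const. }
  assert (Exa : forall m, ex_series (a m)).
  { intros m. apply ex_series_dominated with b; auto. }
  assert (Exl : ex_series l).
  { apply ex_series_dominated with b; auto. }
  apply is_lim_seq_spec. intros eps.
  assert (Htail : exists N, Series (fun k => b (S N + k)%nat) < eps / 4).
  { assert (Hs := Series_correct _ Exb). unfold is_series in Hs.
    assert (Hs' : is_lim_seq (sum_n b) (Series b)) by exact Hs.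
    apply is_lim_seq_spec in Hs'.
    destruct (Hs' (mkposreal (eps / 4) ltac:(pose proof (cond_pos eps); lra))) as [N HN].
    exists N. specialize (HN N (Nat.le_refl _)). simpl in HN.
    rewrite (Series_incr_n b (S N)) in HN by (auto; lia).
    rewrite sum_n_Reals in HN. simpl pred in HN.
    apply Rabs_lt_between in HN. simpl in *. lra. }
  destruct Htail as [N HN].
  assert (Hfin : is_lim_seq (fun m => sum_f_R0 (a m) N) (sum_f_R0 l N)).
  { clear HN. induction N as [|N IH]; simpl; [apply Hl|].
    apply is_lim_seq_plus'; [exact IH|apply Hl]. }
  apply is_lim_seq_spec in Hfin.
  destruct (Hfin (mkposreal (eps / 4) ltac:(pose proof (cond_pos eps); lra))) as [M HM].
  exists M. intros m Hm. specialize (HM m Hm). simpl in HM.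
  rewrite (Series_incr_n (a m) (S N)) by (auto; lia).
  rewrite (Series_incr_n l (S N)) by (auto; lia). simpl pred.
  assert (T : forall u, (forall k, Rabs (u k) <= b k) ->
     Rabs (Series (fun k => u (S N + k)%nat)) <= Series (fun k => b (S N + k)%nat)).
  { intros u Hu. eapply Rle_trans; [apply Series_Rabs|apply Series_le].
    - apply ex_series_dominated with (fun k => b (S N + k)%nat).
      + intros k. rewrite Rabs_Rabsolu. apply Hu.
      + apply (ex_series_incr_n b (S N)), Exb.
    - intros k. split; [apply Rabs_pos|apply Hu].
    - apply (ex_series_incr_n b (S N)), Exb. }
  pose proof (T (a m) (Hb m)) as T1. pose proof (T l Hlb) as T2.
  apply Rabs_lt_between in HM. apply Rabs_le_between in T1. apply Rabs_le_between in T2.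
  pose proof (cond_pos eps).
  apply Rabs_lt_between. lra.
Qed.

Lemma INR_S_pos (k : nat) : 0 < INR (S k).
Proof. apply lt_0_INR; lia. Qed.

(** Comparison with the telescoping series of [1/(k+1) - 1/(k+2)]. *)
Lemma ex_series_inv_sq : ex_series (fun k : nat => / INR (S k) ^ 2).
Proof.
  assert (T : forall n, sum_f_R0 (fun k : nat => / (INR (S k) * INR (S (S k)))) n
                   = 1 - / INR (S (S n))).
  { induction n as [|n IH].
    - simpl. lra.
    - rewrite tech5, IH, (S_INR (S (S n))). pose proof (INR_S_pos (S n)).
      field. lra. }
  assert (Ex : ex_series (fun k : nat => / (INR (S k) * INR (S (S k))))).
  { exists 1. unfold is_series.
    change (is_lim_seq (sum_n (fun k : nat => / (INR (S k) * INR (S (S k))))) 1).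
    apply is_lim_seq_ext with (fun n => 1 - / INR (S (S n))).
    - intros n. now rewrite sum_n_Reals, T.
    - replace (Finite 1) with (Finite (1 - 0)) by (f_equal; ring).
      apply is_lim_seq_minus'; [apply is_lim_seq_const|].
      apply (is_lim_seq_inv (fun n => INR (S (S n))) p_infty); [|discriminate].
      apply is_lim_seq_ext with (fun n => INR (n + 2)); [intros; f_equal; lia|].
      apply -> (is_lim_seq_incr_n INR 2). apply is_lim_seq_INR. }
  apply ex_series_dominated with (fun k : nat => 2 * / (INR (S k) * INR (S (S k)))).
  - intros k. pose proof (INR_S_pos k) as Hk. rewrite (S_INR (S k)).
    assert (1 <= INR (S k)) by (change 1 with (INR 1); apply le_INR; lia).
    set (n := INR (S k)) in *.
    rewrite Rabs_pos_eq by (left; apply Rinv_0_lt_compat; nra).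
    apply Rmult_le_reg_r with (n ^ 2 * (n + 1)); [nra|].
    replace (/ n ^ 2 * (n ^ 2 * (n + 1))) with (n + 1) by (field; lra).
    replace (2 * / (n * (n + 1)) * (n ^ 2 * (n + 1))) with (2 * n) by (field; lra).
    lra.
  - destruct Ex as [l Hl]. exists (2 * l). apply (is_series_scal 2 _ l Hl).
Qed.

(** * Elementary properties of phi_2 *)

Lemma phi2_term_bound (z : R) (k : nat) :
  Rabs (B2 (INR (S k) * z) / INR (S k) ^ 2) <= / INR (S k) ^ 2.
Proof.
  assert (H : 0 < / INR (S k) ^ 2) by (apply Rinv_0_lt_compat, pow_lt, INR_S_pos).
  unfold Rdiv. rewrite Rabs_mult, (Rabs_pos_eq (/ _)) by lra.
  pose proof (B2_bound (INR (S k) * z)). nra.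
Qed.

Lemma ex_series_phi2 (z : R) :
  ex_series (fun k : nat => B2 (INR (S k) * z) / INR (S k) ^ 2).
Proof.
  eapply ex_series_dominated; [apply phi2_term_bound|apply ex_series_inv_sq].
Qed.

Lemma phi2_bound (z : R) : Rabs (phi2 z) <= Series (fun k : nat => / INR (S k) ^ 2).
Proof.
  eapply Rle_trans; [apply Series_Rabs|apply Series_le].
  - eapply ex_series_dominated; [|apply ex_series_inv_sq].
    intros k. rewrite Rabs_Rabsolu. apply phi2_term_bound.
  - intros k. split; [apply Rabs_pos|apply phi2_term_bound].
  - apply ex_series_inv_sq.
Qed.

Lemma B2_lim (u : nat -> R) (l : R) :
  is_lim_seq u l -> is_lim_seq (fun m => B2 (u m)) (B2 l).
Proof.
  intros H. apply (is_lim_seq_continuous B2 u l); [|exact H].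
  apply continuity_pt_filterlim, B2_continuous.
Qed.

Lemma phi2_lim (u : nat -> R) (l : R) :
  is_lim_seq u l -> is_lim_seq (fun m => phi2 (u m)) (phi2 l).
Proof.
  intros H. unfold phi2. eapply tannery.
  - intros k. apply is_lim_seq_div'.
    + apply B2_lim. apply (is_lim_seq_scal_l u (INR (S k)) l), H.
    + apply is_lim_seq_const.
    + apply pow_nonzero. pose proof (INR_S_pos k). lra.
  - intros m k. apply phi2_term_bound.
  - apply ex_series_inv_sq.
Qed.

Lemma phi2_add_IZR (z : Z) (t : R) : phi2 (t + IZR z) = phi2 t.
Proof.
  apply Series_ext. intros k. f_equal.
  rewrite Rmult_plus_distr_l, (INR_IZR_INZ (S k)), <- mult_IZR. apply B2_add_IZR.
Qed.

(** * Two simultaneous Euler-Maclaurin summations *)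

Definition B2_moment (j : nat) (v : R) : R := RInt (fun u => B2 u / u ^ j) 1 v.

Lemma B2_moment_derive (j : nat) (v : R) :
  0 < v -> is_derive (B2_moment j) v (B2 v / v ^ j).
Proof.
  assert (C : forall u, 0 < u -> continuous (fun u => B2 u / u ^ j) u).
  { intros u Hu. apply continuity_pt_filterlim. apply continuity_pt_div.
    - apply continuity_pt_filterlim, B2_continuous.
    - apply derivable_continuous_pt, derivable_pt_pow.
    - apply pow_nonzero. lra. }
  intros Hv. unfold B2_moment.
  apply (is_derive_RInt (fun u => B2 u / u ^ j) _ 1 v); [|now apply C].
  exists (mkposreal v Hv). intros w Hw.
  apply (RInt_correct (fun u => B2 u / u ^ j)).
  apply (ex_RInt_continuous (fun u => B2 u / u ^ j)). intros u Hu. apply C.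
  unfold ball in Hw. simpl in Hw. unfold AbsRing_ball, abs, minus, plus, opp in Hw. simpl in Hw.
  apply Rabs_lt_between in Hw.
  unfold Rmin in Hu. destruct (Rle_dec 1 w); lra.
Qed.

Fixpoint phi2_psum (z : R) (p : nat) : R :=
  match p with
  | O => 0
  | S k => phi2_psum z k + B2 (INR (S k) * z) / INR (S k) ^ 2
  end.

Lemma phi2_psum_lim (z : R) : is_lim_seq (phi2_psum z) (phi2 z).
Proof.
  apply is_lim_seq_incr_1.
  apply is_lim_seq_ext with (sum_n (fun k : nat => B2 (INR (S k) * z) / INR (S k) ^ 2)).
  - induction n as [|n IH].
    + rewrite sum_O. cbn [phi2_psum]. ring.
    + rewrite sum_Sn, IH. reflexivity.
  - exact (Series_correct _ (ex_series_phi2 z)).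
Qed.

(** The Euler-Maclaurin primitive attached to the partial sums of [phi2 z], for
    [p <= t <= p + 1].  Keeping [p] as a parameter, instead of the integer part
    of [t], makes the expression smooth in [t] on a closed cell; consecutive
    cells agree at their common end by [euler_maclaurin_match]. *)
Definition euler_maclaurin (p : nat) (z t : R) : R :=
  (t - INR p - 1 / 2) * (B2 (t * z) / t ^ 2) + phi2_psum z p.

Lemma euler_maclaurin_match (p : nat) (z t : R) :
  t = INR (S p) -> euler_maclaurin p z t = euler_maclaurin (S p) z t.
Proof.
  intros ->. unfold euler_maclaurin. cbn [phi2_psum]. rewrite S_INR. field.
  rewrite <- S_INR. pose proof (INR_S_pos p). lra.
Qed.

(** At a large integer [t = p], with [q] the integer part of [p x], this is close
    to [phi2 x - x^3 phi2 (1/x)] up to multiples of the limit of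
    [B2_moment 2].  The subtracted product of two [B2] and the moments remove
    from the derivative in [t] every term except those with a kernel decaying
    like [t^-3]. *)
Definition two_way_sum (p q : nat) (x t : R) : R :=
  euler_maclaurin p x t - x ^ 3 * euler_maclaurin q (/ x) (t * x)
  - B2 t * B2 (t * x) / t ^ 3
  - x * B2_moment 2 (t * x) + x ^ 2 * B2_moment 2 t.

(** A primitive in [t] of [kernel p t * B2 (t x)], obtained by expanding the
    kernel into powers of [t] and rescaling each moment.  In this form its
    differentiability in [x] is visible, although [B2 (t x)] has corners. *)
Definition kernel_primitive (p : nat) (x t : R) : R :=
  - x * B2_moment 2 (t * x) - (2 * INR p + 1) * x ^ 2 * B2_moment 3 (t * x)
  + 3 * (INR p ^ 2 + INR p + 1 / 6) * x ^ 3 * B2_moment 4 (t * x).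

(** With [b1] and [b2] the first two Bernoulli polynomials at [t - p], this is
    [- 4 b1 / t^3 + 3 b2 / t^4]. *)
Definition kernel (p : nat) (t : R) : R :=
  - 4 * (t - INR p - 1 / 2) / t ^ 3
  + 3 * ((t - INR p) ^ 2 - (t - INR p) + 1 / 6) / t ^ 4.

Lemma kernel_primitive_derive (p : nat) (x t : R) :
  0 < x -> 0 < t ->
  is_derive (kernel_primitive p x) t (kernel p t * B2 (t * x)).
Proof.
  intros Hx Ht.
  assert (Htx : 0 < t * x) by nra.
  pose proof (fun j => B2_moment_derive j _ Htx) as D.
  unfold kernel_primitive, kernel. auto_derive.
  - repeat split; eexists; apply D.
  - rewrite !(is_derive_unique _ _ _ (D _)). field. lra.
Qed.

(** On a cell where the integer parts of [t] and [t x] are [p] and [q], both sides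
    are smooth and have the same derivative: the two Euler-Maclaurin terms both
    produce [2 x (t - p - 1/2) (t x - q - 1/2) / t^2], which cancels in their
    difference. *)
Lemma two_way_sum_cell (p q : nat) (x t0 t1 : R) :
  0 < x -> 0 < t0 <= t1 ->
  INR p <= t0 -> t1 <= INR p + 1 ->
  INR q <= t0 * x -> t1 * x <= INR q + 1 ->
  two_way_sum p q x t1 - kernel_primitive p x t1 =
  two_way_sum p q x t0 - kernel_primitive p x t0.
Proof.
  intros Hx Ht Hp0 Hp1 Hq0 Hq1.
  set (a := fun s : R => (s - INR p) ^ 2 - (s - INR p) + 1 / 6).
  set (b := fun s : R => (s * x - INR q) ^ 2 - (s * x - INR q) + 1 / 6).
  set (W := fun s => (s - INR p - 1 / 2) * (b s / s ^ 2)
     - x ^ 3 * ((s * x - INR q - 1 / 2) * (a s / (s * x) ^ 2))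
     - a s * b s / s ^ 3
     - x * B2_moment 2 (s * x) + x ^ 2 * B2_moment 2 s - kernel_primitive p x s
     + (phi2_psum x p - x ^ 3 * phi2_psum (/ x) q)).
  assert (Ha : forall s, t0 <= s <= t1 -> B2 s = a s).
  { intros s Hs. unfold a. rewrite INR_IZR_INZ in *. apply B2_cell. lra. }
  assert (Hb : forall s, t0 <= s <= t1 -> B2 (s * x) = b s).
  { intros s Hs. unfold b. rewrite (INR_IZR_INZ q) in *. apply B2_cell. nra. }
  assert (HW : forall s, t0 <= s <= t1 ->
             two_way_sum p q x s - kernel_primitive p x s = W s).
  { intros s Hs. unfold two_way_sum, euler_maclaurin, W.
    replace (s * x * / x) with s by (field; lra).
    rewrite (Ha s), (Hb s) by lra. ring. }
  rewrite !HW by lra.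
  destruct (Req_dec t0 t1) as [->|Hne]; [reflexivity|].
  symmetry. apply (eq_is_derive W t0 t1); [|lra].
  intros s Hs.
  assert (Hs0 : 0 < s) by lra.
  assert (Hsx : 0 < s * x) by nra.
  pose proof (B2_moment_derive 2 _ Hsx) as D1.
  pose proof (B2_moment_derive 2 _ Hs0) as D2.
  pose proof (kernel_primitive_derive p x s Hx Hs0) as D3.
  unfold W, a, b. auto_derive.
  - repeat split; try (eexists; eassumption);
      apply Rgt_not_eq; repeat apply Rmult_lt_0_compat; lra.
  - change (fun x0 => kernel_primitive p x x0) with (kernel_primitive p x).
    change (fun x0 => B2_moment 2 x0) with (B2_moment 2).
    rewrite (is_derive_unique _ _ _ D1), (is_derive_unique _ _ _ D2), (is_derive_unique _ _ _ D3).
    rewrite (Ha s), (Hb s) by lra. unfold kernel, a, b, zero; simpl. field. lra.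
Qed.

(** The corners [t = m / x] between [t0] and [t1] are crossed one at a time. *)
Lemma two_way_sum_walk (d p q : nat) (x t0 t1 : R) :
  0 < x -> 0 < t0 <= t1 ->
  INR p <= t0 -> t1 <= INR p + 1 ->
  INR q <= t0 * x <= INR q + 1 ->
  INR (q + d) <= t1 * x <= INR (q + d) + 1 ->
  two_way_sum p (q + d) x t1 - kernel_primitive p x t1 =
  two_way_sum p q x t0 - kernel_primitive p x t0.
Proof.
  revert q t0. induction d as [|d IH]; intros q t0 Hx Ht Hp0 Hp1 Hq0 Hq1.
  - rewrite Nat.add_0_r in *. now apply two_way_sum_cell.
  - replace (q + S d)%nat with (S q + d)%nat in * by lia.
    (* the end of the cell of [t0], where the index [q] changes *)
    set (t := INR (S q) / x).
    assert (Htx : t * x = INR (S q)) by (unfold t; field; lra).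
    assert (HSq : INR (S q) = INR q + 1) by apply S_INR.
    assert (Hd : INR (S q) <= INR (S q + d)) by (apply le_INR; lia).
    assert (H0 : t0 <= t) by (apply Rmult_le_reg_r with x; lra).
    assert (H1 : t <= t1) by (apply Rmult_le_reg_r with x; lra).
    rewrite (IH (S q) t) by lra.
    rewrite <- (two_way_sum_cell p q x t0 t) by lra.
    unfold two_way_sum. now rewrite (euler_maclaurin_match q (/ x) (t * x)).
Qed.

(** The mean value inequality, with the increment of [g] in place of the integral
    of the bound on the derivative. *)
Lemma increment_le (f g df dg : R -> R) (a b : R) :
  a <= b ->
  (forall t, a <= t <= b -> is_derive f t (df t)) ->
  (forall t, a <= t <= b -> is_derive g t (dg t)) ->
  (forall t, a <= t <= b -> Rabs (df t) <= dg t) ->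
  Rabs (f b - f a) <= g b - g a.
Proof.
  intros Hab Hf Hg Hd.
  assert (Hmono : forall h dh, (forall t, a <= t <= b -> is_derive h t (dh t)) ->
            (forall t, a <= t <= b -> 0 <= dh t) -> h a <= h b).
  { intros h dh Hh Hpos.
    destruct (MVT_gen h a b dh) as [c [Hc Ec]];
      rewrite ?Rmin_left, ?Rmax_right in * by lra.
    - intros t Ht. apply Hh. lra.
    - intros t Ht. apply continuity_pt_filterlim.
      apply (ex_derive_continuous h). eexists. apply Hh. lra.
    - specialize (Hpos c Hc). nra. }
  pose proof (Hmono (fun t => g t - f t) (fun t => dg t - df t)) as H1.
  pose proof (Hmono (fun t => g t + f t) (fun t => dg t + df t)) as H2.
  simpl in H1, H2. apply Rabs_le. split.
  - apply Rplus_le_reg_r with (g b - g a). ring_simplify.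
    enough (g a + f a <= g b + f b) by lra. apply H2.
    + intros t Ht. apply (is_derive_plus g f); auto.
    + intros t Ht. specialize (Hd t Ht). apply Rabs_le_between in Hd. lra.
  - enough (g a - f a <= g b - f b) by lra. apply H1.
    + intros t Ht. apply (is_derive_minus g f); auto.
    + intros t Ht. specialize (Hd t Ht). apply Rabs_le_between in Hd. lra.
Qed.

Lemma B2_moment_2_increment (u v : R) :
  0 < u <= v -> Rabs (B2_moment 2 v - B2_moment 2 u) <= / u.
Proof.
  intros H. apply Rle_trans with (- / v - - / u).
  - apply (increment_le (B2_moment 2) (fun t => - / t)
             (fun t => B2 t / t ^ 2) (fun t => / t ^ 2)); [lra| | |].
    + intros t Ht. apply B2_moment_derive. lra.
    + intros t Ht. auto_derive; [lra|]. field. lra.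
    + intros t Ht. assert (Hp : 0 < / t ^ 2) by (apply Rinv_0_lt_compat, pow_lt; lra).
      unfold Rdiv. rewrite Rabs_mult, (Rabs_pos_eq (/ _)) by lra.
      pose proof (B2_bound t). nra.
  - assert (0 < / v) by (apply Rinv_0_lt_compat; lra). lra.
Qed.

Lemma is_lim_seq_inv_INR_S : is_lim_seq (fun n => / INR (S n)) 0.
Proof.
  apply (is_lim_seq_inv (fun n => INR (S n)) p_infty); [|discriminate].
  apply -> (is_lim_seq_incr_1 INR). apply is_lim_seq_INR.
Qed.

(** The scale [x] does not influence the limit, because the increment of the
    moment between two large points is small. *)
Lemma B2_moment_2_lim :
  exists C : R, forall x, 0 < x ->
    is_lim_seq (fun n => B2_moment 2 (INR (S n) * x)) C.
Proof.
  assert (Hc : ex_lim_seq_cauchy (fun n => B2_moment 2 (INR (S n)))).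
  { intros eps. pose proof is_lim_seq_inv_INR_S as L.
    apply is_lim_seq_spec in L. destruct (L eps) as [N HN]. exists N.
    assert (W : forall n m, (N <= n)%nat -> (n <= m)%nat ->
      Rabs (B2_moment 2 (INR (S m)) - B2_moment 2 (INR (S n))) < eps).
    { intros n m Hn Hm. eapply Rle_lt_trans.
      - apply B2_moment_2_increment. split; [apply INR_S_pos|apply le_INR; lia].
      - specialize (HN n Hn). apply Rabs_lt_between in HN. simpl in *. lra. }
    intros n m Hn Hm. destruct (Nat.le_ge_cases n m).
    - rewrite Rabs_minus_sym. now apply W.
    - now apply W. }
  apply ex_lim_seq_cauchy_corr in Hc. destruct Hc as [C HC].
  exists C. intros x Hx.
  apply is_lim_seq_ext with
    (fun n => B2_moment 2 (INR (S n)) +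
              (B2_moment 2 (INR (S n) * x) - B2_moment 2 (INR (S n)))).
  { intros n. ring. }
  replace (Finite C) with (Finite (C + 0)) by (f_equal; ring).
  apply is_lim_seq_plus'; [exact HC|].
  apply is_lim_seq_abs_0.
  apply is_lim_seq_le_le with (fun _ => 0) (fun n => (1 + / x) * / INR (S n)).
  - intros n. split; [apply Rabs_pos|].
    pose proof (INR_S_pos n) as Hn.
    assert (Hi : 0 < / INR (S n)) by now apply Rinv_0_lt_compat.
    assert (Hix : 0 < / x) by now apply Rinv_0_lt_compat.
    destruct (Rle_lt_dec x 1).
    + rewrite Rabs_minus_sym. eapply Rle_trans; [apply B2_moment_2_increment; nra|].
      rewrite Rinv_mult. nra.
    + eapply Rle_trans; [apply B2_moment_2_increment; nra|]. nra.
  - apply is_lim_seq_const.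
  - replace (Finite 0) with (Rbar_mult (1 + / x) 0) by (simpl; f_equal; ring).
    apply is_lim_seq_scal_l, is_lim_seq_inv_INR_S.
Qed.

(** * The reciprocity formula *)

(** The integral of [kernel n t * B2 (t x)] over [n <= t <= n + 1] with
    [n = k + 1]. *)
Definition kernel_integral (x : R) (k : nat) : R :=
  kernel_primitive (S k) x (INR (S (S k))) - kernel_primitive (S k) x (INR (S k)).

Lemma floor_seq_exists (x : R) :
  0 < x -> exists q : nat -> nat, forall n, INR (q n) <= INR n * x < INR (q n) + 1.
Proof.
  intros Hx. exists (fun n => Z.to_nat (Int_part (INR n * x))). intros n.
  pose proof (base_Int_part (INR n * x)) as H.
  assert (0 <= INR n * x) by (pose proof (pos_INR n); nra).
  assert (0 <= Int_part (INR n * x))%Z.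
  { apply Z.lt_succ_r, lt_IZR. rewrite succ_IZR. lra. }
  rewrite INR_IZR_INZ, Z2Nat.id by assumption. lra.
Qed.

Lemma floor_seq_mono (x : R) (q : nat -> nat) :
  0 < x -> (forall n, INR (q n) <= INR n * x < INR (q n) + 1) ->
  forall n, (q n <= q (S n))%nat.
Proof.
  intros Hx Hq n. pose proof (Hq n). pose proof (Hq (S n)) as H'. rewrite S_INR in H'.
  apply Nat.lt_succ_r, INR_lt. rewrite S_INR. nra.
Qed.

Lemma two_way_sum_telescope (x : R) (q : nat -> nat) :
  0 < x -> (forall n, INR (q n) <= INR n * x < INR (q n) + 1) ->
  forall N, two_way_sum (S (S N)) (q (S (S N))) x (INR (S (S N))) =
    two_way_sum 1 (q 1%nat) x 1 + sum_n (kernel_integral x) N.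
Proof.
  intros Hx Hq.
  assert (Step : forall n, two_way_sum (S (S n)) (q (S (S n))) x (INR (S (S n))) =
     two_way_sum (S n) (q (S n)) x (INR (S n)) + kernel_integral x n).
  { intros n. pose proof (floor_seq_mono x q Hx Hq (S n)) as Hm.
    pose proof (Hq (S n)) as H1. pose proof (Hq (S (S n))) as H2.
    pose proof (INR_S_pos n) as Hn. pose proof (S_INR (S n)) as HS.
    pose proof (two_way_sum_walk (q (S (S n)) - q (S n)) (S n) (q (S n)) x
                  (INR (S n)) (INR (S (S n))) Hx) as W.
    replace (q (S n) + (q (S (S n)) - q (S n)))%nat with (q (S (S n))) in W by lia.
    unfold kernel_integral.
    rewrite <- (Rplus_0_r (two_way_sum (S (S n)) _ _ _)).
    replace (two_way_sum (S (S n)) (q (S (S n))) x (INR (S (S n))))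
       with (two_way_sum (S n) (q (S (S n))) x (INR (S (S n))))
      by (unfold two_way_sum; now rewrite (euler_maclaurin_match (S n))).
    assert (W' := W ltac:(lra) ltac:(lra) ltac:(lra) ltac:(lra) ltac:(lra)). lra. }
  induction N as [|N IH].
  - rewrite Step, sum_O. reflexivity.
  - rewrite Step, IH, sum_Sn. unfold plus; simpl. ring.
Qed.

(** The boundary terms of Euler-Maclaurin are [O(1/n)], so that only the two
    partial sums and the two moments contribute to the limit. *)
Lemma two_way_sum_lim (x : R) (q : nat -> nat) (C : R) :
  0 < x -> (forall n, INR (q n) <= INR n * x < INR (q n) + 1) ->
  (forall y, 0 < y -> is_lim_seq (fun n => B2_moment 2 (INR (S n) * y)) C) ->
  is_lim_seq (fun n => two_way_sum (S n) (q (S n)) x (INR (S n)))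
    (phi2 x - x ^ 3 * phi2 (/ x) - x * C + x ^ 2 * C).
Proof.
  intros Hx Hq HC. unfold two_way_sum.
  assert (Small : forall w : nat -> R, (forall n, Rabs (w n) <= 1) -> forall c : R,
            is_lim_seq (fun n => w n * c * / INR (S n)) 0).
  { intros w Hw c. apply is_lim_seq_abs_0.
    apply is_lim_seq_le_le with (fun _ => 0) (fun n => Rabs c * / INR (S n)).
    - intros n. split; [apply Rabs_pos|].
      assert (0 < / INR (S n)) by apply Rinv_0_lt_compat, INR_S_pos.
      rewrite !Rabs_mult, (Rabs_pos_eq (/ _)) by lra.
      apply Rmult_le_compat_r; [lra|]. pose proof (Hw n). pose proof (Rabs_pos c). nra.
    - apply is_lim_seq_const.
    - replace (Finite 0) with (Rbar_mult (Rabs c) 0) by (simpl; f_equal; ring).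
      apply is_lim_seq_scal_l, is_lim_seq_inv_INR_S. }
  assert (Hinv : forall n, 0 < / INR (S n) <= 1).
  { intros n. split; [apply Rinv_0_lt_compat, INR_S_pos|].
    rewrite <- Rinv_1. apply Rinv_le_contravar; [lra|].
    change 1 with (INR 1). apply le_INR. lia. }
  assert (Prod : forall u v, Rabs u <= 1 -> 0 < v <= 1 -> Rabs (u * v) <= 1).
  { intros u v Hu Hv. rewrite Rabs_mult, (Rabs_pos_eq v) by lra.
    pose proof (Rabs_pos u). nra. }
  assert (HB : forall t, Rabs (B2 t) <= 1) by (intros t; pose proof (B2_bound t); lra).
  apply is_lim_seq_plus'; [apply is_lim_seq_minus'; [|apply (is_lim_seq_scal_l _ x C), (HC x Hx)]|].
  2:{ apply (is_lim_seq_scal_l _ (x ^ 2) C). generalize (HC 1 Rlt_0_1).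
      apply is_lim_seq_ext. intros n. f_equal. ring. }
  replace (phi2 x - x ^ 3 * phi2 (/ x)) with (phi2 x - x ^ 3 * phi2 (/ x) - 0) by ring.
  apply is_lim_seq_minus'; [apply is_lim_seq_minus'|].
  - unfold euler_maclaurin.
    replace (phi2 x) with (0 + phi2 x) by ring. apply is_lim_seq_plus'.
    + apply is_lim_seq_ext with
        (fun n => (B2 (INR (S n) * x) * / INR (S n)) * (- (1 / 2)) * / INR (S n)).
      * intros n. field. pose proof (INR_S_pos n). lra.
      * apply Small. intros n. apply Prod; auto.
    + apply -> (is_lim_seq_incr_1 (phi2_psum x)). apply phi2_psum_lim.
  - apply (is_lim_seq_scal_l _ (x ^ 3) (phi2 (/ x))). unfold euler_maclaurin.
    replace (phi2 (/ x)) with (0 + phi2 (/ x)) by ring. apply is_lim_seq_plus'.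
    + apply is_lim_seq_ext with
        (fun n => ((INR (S n) * x - INR (q (S n)) - 1 / 2) *
                     (B2 (INR (S n) * x * / x) * / INR (S n))) * (/ x ^ 2) * / INR (S n)).
      * intros n. field. pose proof (INR_S_pos n). lra.
      * apply Small. intros n. rewrite Rabs_mult.
        assert (Rabs (INR (S n) * x - INR (q (S n)) - 1 / 2) <= 1).
        { pose proof (Hq (S n)). apply Rabs_le. lra. }
        pose proof (Prod _ _ (HB (INR (S n) * x * / x)) (Hinv n)).
        pose proof (Rabs_pos (INR (S n) * x - INR (q (S n)) - 1 / 2)).
        pose proof (Rabs_pos (B2 (INR (S n) * x * / x) * / INR (S n))). nra.
    + apply (is_lim_seq_subseq (phi2_psum (/ x)) _ (fun n => q (S n))); [|apply phi2_psum_lim].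
      intros P [M HM]. destruct (INR_unbounded ((INR M + 1) / x)) as [N HN].
      exists N. intros n Hn. apply HM.
      pose proof (Hq (S n)) as H. apply le_INR in Hn.
      assert (H1 : INR M + 1 < INR N * x).
      { apply (Rmult_lt_compat_r x) in HN; [|lra].
        replace ((INR M + 1) / x * x) with (INR M + 1) in HN by (field; lra). lra. }
      rewrite S_INR in H.
      apply INR_le. nra.
  - apply is_lim_seq_ext with
      (fun n => ((B2 (INR (S n)) * B2 (INR (S n) * x)) * / INR (S n) * / INR (S n)) * 1 * / INR (S n)).
    + intros n. field. pose proof (INR_S_pos n). lra.
    + apply Small. intros n. apply Prod; [apply Prod|]; auto.
      rewrite Rabs_mult. pose proof (HB (INR (S n))). pose proof (HB (INR (S n) * x)).
      pose proof (Rabs_pos (B2 (INR (S n)))). pose proof (Rabs_pos (B2 (INR (S n) * x))). nra.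
Qed.

Lemma B2_moment_at_1 (j : nat) : B2_moment j 1 = 0.
Proof. exact (RInt_point 1 (fun u => B2 u / u ^ j)). Qed.

(** This is the source of the logarithm in the reciprocity formula: for [u < 1]
    the function [B2 u / u^2] is [1 - 1/u + 1/(6 u^2)]. *)
Lemma B2_moment_2_unit (x : R) :
  0 < x < 1 -> B2_moment 2 x = x - ln x - / (6 * x) - 5 / 6.
Proof.
  intros Hx.
  enough (E : B2_moment 2 x - (x - ln x - / (6 * x)) = B2_moment 2 1 - (1 - ln 1 - / (6 * 1))).
  { rewrite B2_moment_at_1, ln_1 in E. lra. }
  apply (eq_is_derive (fun t => B2_moment 2 t - (t - ln t - / (6 * t))) x 1); [|lra].
  intros t Ht.
  assert (D : is_derive (B2_moment 2) t (B2 t / t ^ 2)) by (apply B2_moment_derive; lra).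
  auto_derive.
  - repeat split; try lra. now eexists; apply D.
  - change (fun x0 => B2_moment 2 x0) with (B2_moment 2).
    rewrite (is_derive_unique _ _ _ D), (B2_cell 0 t) by lra.
    unfold zero; simpl. field. lra.
Qed.

(** The two-way sum is evaluated at [t = 1] explicitly and at infinity as a limit;
    its increments in between are the kernel integrals.  The condition [x < 1]
    ensures that no index [m] has [m / x < 1], so that the second sum is empty
    at [t = 1]. *)
Lemma phi2_reciprocity :
  exists c0 c1 c2 : R, forall x, 0 < x < 1 ->
    phi2 x - x ^ 3 * phi2 (/ x) =
    x * ln x + (c0 + c1 * x + c2 * x ^ 2) + Series (kernel_integral x).
Proof.
  destruct B2_moment_2_lim as [C HC].
  (* [2/9 + 7/12 x - 5/6 x^2 + x ln x] is the value at [t = 1]; the multiples of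
     [C] are the limits of the two moment terms. *)
  exists (2 / 9), (7 / 12 + C), (- (5 / 6) - C). intros x Hx.
  destruct (floor_seq_exists x) as [q Hq]; [lra|].
  pose proof (two_way_sum_lim x q C ltac:(lra) Hq HC) as L.
  apply is_lim_seq_incr_1 in L.
  assert (q1 : q 1%nat = 0%nat).
  { destruct (Hq 1%nat) as [H _]. simpl INR in H.
    enough (q 1 < 1)%nat by lia. apply INR_lt. simpl. lra. }
  assert (E1 : two_way_sum 1 (q 1%nat) x 1 =
     x * ln x + (2 / 9 + 7 / 12 * x - 5 / 6 * x ^ 2)).
  { rewrite q1. unfold two_way_sum, euler_maclaurin. cbn [phi2_psum INR].
    rewrite B2_moment_at_1, !Rmult_1_l, Rinv_r by lra.
    rewrite (B2_moment_2_unit x Hx), (B2_cell 0 x), (B2_cell 0 1) by lra. field. lra. }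
  assert (S1 : is_series (kernel_integral x)
     (phi2 x - x ^ 3 * phi2 (/ x) - x * C + x ^ 2 * C - two_way_sum 1 (q 1%nat) x 1)).
  { apply (is_lim_seq_ext (fun n => two_way_sum (S (S n)) (q (S (S n))) x (INR (S (S n)))
               - two_way_sum 1 (q 1%nat) x 1) (sum_n (kernel_integral x))
             (phi2 x - x ^ 3 * phi2 (/ x) - x * C + x ^ 2 * C - two_way_sum 1 (q 1%nat) x 1)).
    - intros n. rewrite (two_way_sum_telescope x q) by (auto; lra). ring.
    - apply is_lim_seq_minus'; [exact L|apply is_lim_seq_const]. }
  apply is_series_unique in S1. rewrite S1, E1. ring.
Qed.

(** * The smooth part of the reciprocity formula *)

(** The extra factor [t] is the Lipschitz constant of [x |-> B2 (t x)]; the bound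
    is still summable, because the kernel decays like [t^-3]. *)
Lemma kernel_bound (k : nat) (t : R) :
  INR (S k) <= t <= INR (S (S k)) ->
  Rabs (kernel (S k) t) * t <= 3 * / INR (S k) ^ 2.
Proof.
  intros Ht. rewrite (S_INR (S k)) in Ht.
  assert (Hn : 1 <= INR (S k)) by (change 1 with (INR 1); apply le_INR; lia).
  unfold kernel. set (n := INR (S k)) in *.
  set (N := - 4 * (t - n - 1 / 2) * t + 3 * ((t - n) ^ 2 - (t - n) + 1 / 6)).
  assert (HN : Rabs N <= 3 * t) by (unfold N; apply Rabs_le; split; nra).
  assert (H4 : 0 < / t ^ 4) by (apply Rinv_0_lt_compat, pow_lt; lra).
  replace (- 4 * (t - n - 1 / 2) / t ^ 3 + 3 * ((t - n) ^ 2 - (t - n) + 1 / 6) / t ^ 4)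
    with (N * / t ^ 4) by (unfold N; field; lra).
  rewrite Rabs_mult, (Rabs_pos_eq (/ _)) by lra.
  apply Rle_trans with (3 * / t ^ 2).
  - replace (3 * / t ^ 2) with (3 * t * / t ^ 4 * t) by (field; lra).
    apply Rmult_le_compat_r; [lra|]. apply Rmult_le_compat_r; lra.
  - apply Rmult_le_compat_l; [lra|]. apply Rinv_le_contravar; [nra|]. nra.
Qed.

Lemma kernel_integral_bound (x : R) (k : nat) :
  0 < x -> Rabs (kernel_integral x k) <= 3 * / INR (S k) ^ 2.
Proof.
  intros Hx. pose proof (S_INR (S k)) as HS.
  assert (Hn : 1 <= INR (S k)) by (change 1 with (INR 1); apply le_INR; lia).
  set (c := 3 * / INR (S k) ^ 2).
  replace c with (c * INR (S (S k)) - c * INR (S k)) by (rewrite HS; ring).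
  apply (increment_le _ (fun t => c * t)
           (fun t => kernel (S k) t * B2 (t * x)) (fun _ => c)); [lra| | |].
  - intros t Ht. apply kernel_primitive_derive; lra.
  - intros t Ht. auto_derive; [easy|ring].
  - intros t Ht. eapply Rle_trans; [|apply (kernel_bound k t); lra].
    rewrite Rabs_mult. pose proof (B2_bound (t * x)). pose proof (Rabs_pos (kernel (S k) t)).
    apply Rmult_le_compat_l; lra.
Qed.

Lemma kernel_integral_lipschitz (x y : R) (k : nat) :
  0 < x -> 0 < y ->
  Rabs (kernel_integral y k - kernel_integral x k) <= 3 * / INR (S k) ^ 2 * Rabs (y - x).
Proof.
  intros Hx Hy. pose proof (S_INR (S k)) as HS.
  assert (Hn : 1 <= INR (S k)) by (change 1 with (INR 1); apply le_INR; lia).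
  set (c := 3 * / INR (S k) ^ 2 * Rabs (y - x)).
  set (f := fun t => kernel_primitive (S k) y t - kernel_primitive (S k) x t).
  replace (kernel_integral y k - kernel_integral x k)
    with (f (INR (S (S k))) - f (INR (S k))) by (unfold f, kernel_integral; ring).
  replace c with (c * INR (S (S k)) - c * INR (S k)) by (rewrite HS; ring).
  apply (increment_le f (fun t => c * t)
           (fun t => kernel (S k) t * B2 (t * y) - kernel (S k) t * B2 (t * x))
           (fun _ => c)); [lra| | |].
  - intros t Ht. apply (is_derive_minus (kernel_primitive (S k) y));
      apply kernel_primitive_derive; lra.
  - intros t Ht. auto_derive; [easy|ring].
  - intros t Ht. rewrite <- Rmult_minus_distr_l, Rabs_mult.
    apply Rle_trans with (Rabs (kernel (S k) t) * t * Rabs (y - x)).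
    + rewrite Rmult_assoc. apply Rmult_le_compat_l; [apply Rabs_pos|].
      eapply Rle_trans; [apply B2_lipschitz|].
      rewrite <- Rmult_minus_distr_l, Rabs_mult, (Rabs_pos_eq t); lra.
    + apply Rmult_le_compat_r; [apply Rabs_pos|]. apply kernel_bound. lra.
Qed.

Lemma kernel_integral_ex_derive (x : R) (k : nat) :
  0 < x -> ex_derive (fun y => kernel_integral y k) x.
Proof.
  intros Hx.
  assert (D : forall j t, 0 < t -> ex_derive (B2_moment j) (t * x)).
  { intros j t Ht. eexists. apply B2_moment_derive. nra. }
  unfold kernel_integral, kernel_primitive.
  generalize (INR_S_pos (S k)) (INR_S_pos k).
  generalize (INR (S (S k))) (INR (S k)). intros a b Ha Hb.
  auto_derive. repeat split; now apply D.
Qed.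

Lemma ex_series_bound_kernel_integral : ex_series (fun k => 3 * / INR (S k) ^ 2).
Proof.
  destruct ex_series_inv_sq as [l Hl]. exists (3 * l). apply (is_series_scal 3 _ l Hl).
Qed.

Lemma ex_series_kernel_integral (x : R) : 0 < x -> ex_series (kernel_integral x).
Proof.
  intros Hx. eapply ex_series_dominated; [|apply ex_series_bound_kernel_integral].
  intros k. now apply kernel_integral_bound.
Qed.

(** * Slopes of phi_2 under inversion *)

Definition slope (f : R -> R) (x y : R) : R := (f y - f x) / (y - x).

Lemma slope_lim (f : R -> R) (x l : R) (u : nat -> R) :
  is_derive f x l -> (forall m, u m <> x) -> is_lim_seq u x ->
  is_lim_seq (fun m => slope f x (u m)) l.
Proof.
  intros D Hne Hu. apply is_derive_Reals in D.
  apply is_lim_seq_spec. intros eps.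
  destruct (D eps (cond_pos eps)) as [delta Hd].
  apply is_lim_seq_spec in Hu. destruct (Hu delta) as [N HN].
  exists N. intros m Hm. specialize (HN m Hm). specialize (Hne m).
  assert (Hh : u m - x <> 0) by lra.
  specialize (Hd (u m - x) Hh HN). unfold slope.
  now replace (x + (u m - x)) with (u m) in Hd by ring.
Qed.

Lemma slope_kernel_integral (x y : R) :
  0 < x -> 0 < y ->
  slope (fun z => Series (kernel_integral z)) x y =
  Series (fun k => slope (fun z => kernel_integral z k) x y).
Proof.
  intros Hx Hy. unfold slope, Rdiv.
  rewrite <- Series_minus by now apply ex_series_kernel_integral.
  now rewrite <- Series_scal_r.
Qed.

Lemma slope_kernel_integral_bound (x y : R) (k : nat) :
  0 < x -> 0 < y -> y <> x ->
  Rabs (slope (fun z => kernel_integral z k) x y) <= 3 * / INR (S k) ^ 2.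
Proof.
  intros Hx Hy Hne. unfold slope, Rdiv.
  assert (H : 0 < Rabs (y - x)) by (apply Rabs_pos_lt; lra).
  rewrite Rabs_mult, Rabs_inv.
  apply Rmult_le_reg_r with (Rabs (y - x)); [exact H|].
  rewrite Rmult_assoc, Rinv_l, Rmult_1_r by lra.
  now apply kernel_integral_lipschitz.
Qed.

(** The slope of [ln] lies between [1/x] and [1/y], hence the product with [y]
    between 1 and [y / x], and [y / x <= 1 + y] when [1/x <= 1/y + 1]. *)
Lemma slope_ln_bound (x y : R) :
  0 < x < 1 -> 0 < y < 1 -> y <> x -> Rabs (/ y - / x) <= 1 ->
  0 <= y * slope ln x y <= 2.
Proof.
  assert (L : forall a b, 0 < a < b -> 0 < ln b - ln a <= (b - a) / a).
  { intros a b H. split.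
    - assert (ln a < ln b) by (apply ln_increasing; lra). lra.
    - rewrite <- ln_div by lra.
      assert (Hba : 0 < b / a) by (apply Rdiv_lt_0_compat; lra).
      pose proof (exp_ineq1_le (ln (b / a))) as E. rewrite exp_ln in E by exact Hba.
      replace ((b - a) / a) with (b / a - 1) by (field; lra). lra. }
  intros Hx Hy Hne Hxy. unfold slope.
  destruct (Rlt_le_dec x y) as [H|H].
  - destruct (L x y) as [L1 L2]; [lra|].
    assert (B : y / x <= 2).
    { apply Rabs_le_between in Hxy. assert (0 < / x) by (apply Rinv_0_lt_compat; lra).
      assert (y * / y = 1) by (field; lra). unfold Rdiv. nra. }
    split.
    + apply Rmult_le_pos; [lra|]. apply Rdiv_le_0_compat; lra.
    + eapply Rle_trans; [|exact B].
      replace (y / x) with (y * ((y - x) / x / (y - x))) by (field; lra).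
      apply Rmult_le_compat_l; [lra|]. apply Rmult_le_compat_r; [|exact L2].
      left; apply Rinv_0_lt_compat; lra.
  - destruct (L y x) as [L1 L2]; [lra|].
    replace ((ln y - ln x) / (y - x)) with ((ln x - ln y) / (x - y)) by (field; lra).
    split.
    + apply Rmult_le_pos; [lra|]. apply Rdiv_le_0_compat; lra.
    + apply Rle_trans with 1; [|lra].
      replace 1 with (y * ((x - y) / y / (x - y))) by (field; lra).
      apply Rmult_le_compat_l; [lra|]. apply Rmult_le_compat_r; [|exact L2].
      left; apply Rinv_0_lt_compat; lra.
Qed.

Definition slope_error (x y : R) : R :=
  slope phi2 x y + x * slope phi2 (/ x) (/ y) - ln x.

(** The slope of the reciprocity formula, rearranged; the factor [x^3] turns into
    the weight [x] because [1/y - 1/x = - (y - x) / (x y)], and the difference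
    between [y^3] and [x^2 y] is absorbed by the values of [phi2]. *)
Lemma slope_error_formula :
  exists c1 c2 : R, forall x y, 0 < x < 1 -> 0 < y < 1 -> y <> x ->
    slope_error x y =
    y * slope ln x y + (c1 + c2 * (x + y))
    + Series (fun k => slope (fun z => kernel_integral z k) x y)
    + (y * (x + y) * phi2 (/ y) + x ^ 2 * phi2 (/ x)).
Proof.
  destruct phi2_reciprocity as (c0 & c1 & c2 & Rec).
  exists c1, c2. intros x y Hx Hy Hne.
  rewrite <- slope_kernel_integral by lra.
  pose proof (Rec x Hx) as Rx. pose proof (Rec y Hy) as Ry.
  unfold slope_error, slope.
  assert (Ex : phi2 x = x ^ 3 * phi2 (/ x) + x * ln x + (c0 + c1 * x + c2 * x ^ 2)
                 + Series (kernel_integral x)) by lra.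
  assert (Ey : phi2 y = y ^ 3 * phi2 (/ y) + y * ln y + (c0 + c1 * y + c2 * y ^ 2)
                 + Series (kernel_integral y)) by lra.
  rewrite Ex, Ey.
  replace (/ y - / x) with ((x - y) * (/ x * / y)) by (field; lra).
  generalize (phi2 (/ x)) (phi2 (/ y)). intros a b. field. lra.
Qed.

Lemma slope_error_control :
  exists C : R, forall x, 0 < x < 1 ->
    (forall y, 0 < y < 1 -> y <> x -> Rabs (/ y - / x) <= 1 ->
       Rabs (slope_error x y) <= C) /\
    (exists l : R, forall u : nat -> R,
       (forall m, 0 < u m < 1 /\ u m <> x) -> is_lim_seq u x ->
       is_lim_seq (fun m => slope_error x (u m)) l).
Proof.
  destruct slope_error_formula as (c1 & c2 & F).
  set (P := Series (fun k : nat => / INR (S k) ^ 2)).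
  exists (2 + Rabs c1 + 2 * Rabs c2 + Series (fun k => 3 * / INR (S k) ^ 2) + 3 * P).
  intros x Hx. split.
  - intros y Hy Hne Hxy. rewrite F by assumption.
    pose proof (slope_ln_bound x y Hx Hy Hne Hxy) as HL.
    pose proof (phi2_bound (/ y)) as Py. pose proof (phi2_bound (/ x)) as Px. fold P in Px, Py.
    assert (HS : Rabs (Series (fun k => slope (fun z => kernel_integral z k) x y))
                   <= Series (fun k => 3 * / INR (S k) ^ 2)).
    { eapply Rle_trans; [apply Series_Rabs|apply Series_le].
      - eapply ex_series_dominated; [|apply ex_series_bound_kernel_integral].
        intros k. rewrite Rabs_Rabsolu. apply slope_kernel_integral_bound; lra.
      - intros k. split; [apply Rabs_pos|]. apply slope_kernel_integral_bound; lra.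
      - apply ex_series_bound_kernel_integral. }
    assert (Hp : forall c d M, Rabs d <= M -> 0 <= c -> Rabs (c * d) <= c * M).
    { intros c d M Hd Hc. rewrite Rabs_mult, (Rabs_pos_eq c) by exact Hc.
      now apply Rmult_le_compat_l. }
    assert (P0 : 0 <= P) by (pose proof (Rabs_pos (phi2 (/ x))); lra).
    assert (T1 : Rabs (y * slope ln x y) <= 2) by (rewrite Rabs_pos_eq; lra).
    assert (T2 : Rabs (c1 + c2 * (x + y)) <= Rabs c1 + 2 * Rabs c2).
    { eapply Rle_trans; [apply Rabs_triang|]. apply Rplus_le_compat_l.
      rewrite Rabs_mult, (Rabs_pos_eq (x + y)) by lra. pose proof (Rabs_pos c2). nra. }
    assert (T3 : Rabs (y * (x + y) * phi2 (/ y)) <= 2 * P).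
    { eapply Rle_trans; [apply (Hp _ _ P Py); nra|].
      assert (0 <= (1 - y) * (x + y)) by (apply Rmult_le_pos; lra).
      apply Rmult_le_compat_r; lra. }
    assert (T4 : Rabs (x ^ 2 * phi2 (/ x)) <= P).
    { eapply Rle_trans; [apply (Hp _ _ P Px); nra|].
      assert (x ^ 2 <= 1) by nra. nra. }
    apply Rabs_le_between in T1, T2, T3, T4, HS. apply Rabs_le. lra.
  - exists (x * / x + (c1 + c2 * (x + x))
       + Series (fun k => Derive (fun z => kernel_integral z k) x)
       + (x * (x + x) * phi2 (/ x) + x ^ 2 * phi2 (/ x))).
    intros u Hu L.
    apply is_lim_seq_ext with (fun m => u m * slope ln x (u m) + (c1 + c2 * (x + u m))
      + Series (fun k => slope (fun z => kernel_integral z k) x (u m))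
      + (u m * (x + u m) * phi2 (/ u m) + x ^ 2 * phi2 (/ x))).
    { intros m. destruct (Hu m). now rewrite F. }
    assert (Hne : forall m, u m <> x) by (intros m; apply Hu).
    assert (Lx : is_lim_seq (fun m => x + u m) (x + x))
      by (apply is_lim_seq_plus'; [apply is_lim_seq_const|exact L]).
    apply is_lim_seq_plus'; [apply is_lim_seq_plus'; [apply is_lim_seq_plus'|]|
      apply is_lim_seq_plus'; [|apply is_lim_seq_const]].
    + apply is_lim_seq_mult'; [exact L|].
      apply slope_lim; try assumption. apply is_derive_ln. lra.
    + apply is_lim_seq_plus'; [apply is_lim_seq_const|].
      apply (is_lim_seq_scal_l _ c2 (x + x)), Lx.
    + apply (tannery (fun m k => slope (fun z => kernel_integral z k) x (u m)) _
               (fun k => 3 * / INR (S k) ^ 2)).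
      * intros k. apply slope_lim; try assumption.
        apply Derive_correct, kernel_integral_ex_derive. lra.
      * intros m k. destruct (Hu m). apply slope_kernel_integral_bound; lra.
      * apply ex_series_bound_kernel_integral.
    + apply is_lim_seq_mult'; [now apply is_lim_seq_mult'|].
      apply phi2_lim. apply (is_lim_seq_inv u x); [exact L|].
      intros E. injection E. lra.
Qed.

(** * Continued fractions *)

Definition irrational_unit (x : R) : Prop := 0 < x < 1 /\ irrational x.

Lemma irrational_nonzero (x : R) : irrational x -> x <> 0.
Proof. intros H E. apply (H 0%Q). rewrite E. unfold Q2R. simpl. field. Qed.

Lemma irrational_frac_part (x : R) : irrational x -> irrational_unit (frac_part x).
Proof.
  intros H.
  assert (I : irrational (frac_part x)).
  { intros q Hq. apply (H (q + inject_Z (Int_part x))%Q).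
    rewrite Q2R_plus, <- Hq. unfold frac_part, Q2R. simpl. field. }
  split; [|exact I].
  pose proof (frac_part_bounds x). pose proof (irrational_nonzero _ I). lra.
Qed.

Lemma irrational_inv (x : R) : irrational x -> irrational (/ x).
Proof.
  intros H q Hq. pose proof (irrational_nonzero _ H) as H0.
  apply (H (/ q)%Q). rewrite Q2R_inv, <- Hq; [now rewrite Rinv_inv|].
  intros E. apply Qeq_eqR in E. rewrite <- Hq in E.
  apply (Rinv_neq_0_compat x H0). rewrite E. unfold Q2R. simpl. field.
Qed.

Lemma irrational_unit_alpha (x : R) : irrational_unit x -> irrational_unit (alpha x).
Proof. intros [_ H]. apply irrational_frac_part, irrational_inv, H. Qed.

Lemma irrational_unit_alpha_iter (k : nat) (x : R) :
  irrational_unit x -> irrational_unit (alpha_iter k x).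
Proof. intros H. induction k as [|k IH]; [exact H|]. now apply irrational_unit_alpha. Qed.

Lemma alpha_iter_alpha (k : nat) (x : R) : alpha_iter k (alpha x) = alpha_iter (S k) x.
Proof. induction k as [|k IH]; [reflexivity|]. cbn [alpha_iter] in *. now rewrite IH. Qed.

Lemma beta_pred_alpha (k : nat) (x : R) : beta_pred (S k) x = x * beta_pred k (alpha x).
Proof.
  induction k as [|k IH]; [simpl; ring|].
  change (beta_pred (S (S k)) x) with (beta_pred (S k) x * alpha_iter (S k) x).
  rewrite IH. cbn [beta_pred]. rewrite alpha_iter_alpha. ring.
Qed.

Lemma inv_sub_alpha (x : R) : 0 < x < 1 -> 1 <= / x - alpha x.
Proof.
  intros Hx. unfold alpha, frac_part.
  assert (H : 1 < / x) by (rewrite <- Rinv_1; apply Rinv_lt_contravar; lra).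
  pose proof (base_Int_part (/ x)).
  assert (0 < Int_part (/ x))%Z by (apply lt_IZR; lra).
  assert (1 <= IZR (Int_part (/ x))) by (apply IZR_le; lia). lra.
Qed.

Lemma mul_alpha_le (x : R) : irrational_unit x -> x * alpha x <= 1 / 2.
Proof.
  intros H. pose proof (inv_sub_alpha x (proj1 H)) as H1.
  destruct (irrational_unit_alpha x H) as [Ha _]. destruct H as [Hx _].
  assert (x * / x = 1) by (field; lra). nra.
Qed.

(** Two steps of the Gauss map multiply [beta] by at most [1/2 <= (3/4)^2]; the
    factor [4/3] makes the bound true at the two initial indices. *)
Lemma beta_pred_bound (k : nat) :
  forall x, irrational_unit x -> 0 < beta_pred k x <= 4 / 3 * (3 / 4) ^ k.
Proof.
  induction k as [k IH] using lt_wf_ind. intros x Hx.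
  destruct k as [|[|k]].
  - simpl. lra.
  - destruct Hx. simpl. lra.
  - pose proof (mul_alpha_le x Hx) as Hm. pose proof (irrational_unit_alpha x Hx) as Ha.
    rewrite !beta_pred_alpha, <- Rmult_assoc.
    destruct (IH k ltac:(lia) _ (irrational_unit_alpha _ Ha)) as [B0 B1].
    destruct Ha as [Ha _]. destruct Hx as [Hx _].
    assert (0 < x * alpha x) by nra.
    assert (0 < (3 / 4) ^ k) by (apply pow_lt; lra).
    cbn [pow]. split; [nra|].
    apply Rle_trans with (1 / 2 * (4 / 3 * (3 / 4) ^ k)); [|lra].
    apply Rmult_le_compat; lra.
Qed.

Lemma ex_series_beta_pred_bound (c : R) : ex_series (fun k => c * (4 / 3 * (3 / 4) ^ k)).
Proof.
  destruct (ex_series_geom (3 / 4)) as [l Hl]; [rewrite Rabs_pos_eq; lra|].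
  exists (c * (4 / 3 * l)).
  apply (is_series_scal c (fun k => 4 / 3 * (3 / 4) ^ k) (4 / 3 * l)).
  apply (is_series_scal (4 / 3) _ l Hl).
Qed.

(** Since [/ x - alpha x] is the first partial quotient of [x], this replaces
    [alpha_m(x)] by [alpha_m(x) + 1] at the end of the continued fraction
    [1/(a_1 + 1/(... + 1/(a_m + alpha_m(x))))] of [x]. *)
Fixpoint companion (m : nat) (x : R) : R :=
  match m with
  | O => x + 1
  | S n => / (/ x - alpha x + companion n (alpha x))
  end.

(** Inversion maps [companion (S m) x - x] to the corresponding difference for
    [alpha x], up to sign and the factor [x * companion (S m) x <= x]. *)
Lemma companion_spec (m : nat) :
  forall x, irrational_unit x ->
    0 < companion m x /\ companion m x <> x /\
    Rabs (companion m x - x) <= beta_pred m x <= 1.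
Proof.
  induction m as [|m IH]; intros x Hx.
  - destruct Hx as [Hx _]. simpl. repeat split; try lra.
    replace (x + 1 - x) with 1 by ring. rewrite Rabs_R1. lra.
  - pose proof (inv_sub_alpha x (proj1 Hx)) as Hi.
    destruct (IH _ (irrational_unit_alpha x Hx)) as (H1 & H2 & H3 & H4).
    rewrite beta_pred_alpha. cbn [companion].
    set (y := companion m (alpha x)) in *.
    assert (Hb : 0 < beta_pred m (alpha x))
      by (apply beta_pred_bound, irrational_unit_alpha, Hx).
    destruct Hx as [Hx _].
    assert (D : / (/ x - alpha x + y) - x =
                - (x * / (/ x - alpha x + y)) * (y - alpha x)).
    { set (d := / x - alpha x + y) in *.
      replace (y - alpha x) with (d - / x) by (unfold d; ring).
      assert (0 < d) by (unfold d; lra). field. lra. }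
    assert (HI : 0 < / (/ x - alpha x + y) <= 1).
    { split; [apply Rinv_0_lt_compat; lra|].
      rewrite <- Rinv_1. apply Rinv_le_contravar; lra. }
    repeat split.
    + lra.
    + intros E. assert (Z : / (/ x - alpha x + y) - x = 0) by lra.
      rewrite D in Z. apply Rmult_integral in Z. destruct Z; [nra|lra].
    + rewrite D, Rabs_mult, Rabs_Ropp, Rabs_pos_eq by nra.
      apply Rle_trans with (x * Rabs (y - alpha x)).
      * apply Rmult_le_compat_r; [apply Rabs_pos|]. nra.
      * apply Rmult_le_compat_l; lra.
    + nra.
Qed.

Lemma companion_S_spec (m : nat) (x : R) :
  irrational_unit x ->
  0 < companion (S m) x < 1 /\ companion (S m) x <> x /\
  Rabs (/ companion (S m) x - / x) <= 1.
Proof.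
  intros Hx. destruct (companion_spec (S m) x Hx) as (H0 & H1 & _).
  destruct (companion_spec m _ (irrational_unit_alpha x Hx)) as (H2 & _ & H3 & H4).
  pose proof (inv_sub_alpha x (proj1 Hx)) as Hi.
  repeat split; try assumption.
  - cbn [companion]. rewrite <- Rinv_1. apply Rinv_lt_contravar; lra.
  - cbn [companion]. rewrite Rinv_inv.
    replace (/ x - alpha x + companion m (alpha x) - / x)
      with (companion m (alpha x) - alpha x) by ring. lra.
Qed.

Lemma companion_lim (x : R) :
  irrational_unit x -> is_lim_seq (fun m => companion m x) x.
Proof.
  intros Hx.
  apply is_lim_seq_ext with (fun m => x + (companion m x - x)); [intros; ring|].
  replace (Finite x) with (Finite (x + 0)) by (f_equal; ring).
  apply is_lim_seq_plus'; [apply is_lim_seq_const|].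
  apply is_lim_seq_abs_0.
  apply is_lim_seq_le_le with (fun _ => 0) (fun m => 4 / 3 * (3 / 4) ^ m).
  - intros m. split; [apply Rabs_pos|].
    destruct (companion_spec m x Hx) as (_ & _ & H & _).
    pose proof (beta_pred_bound m x Hx). lra.
  - apply is_lim_seq_const.
  - replace (Finite 0) with (Rbar_mult (4 / 3) 0) by (simpl; f_equal; ring).
    apply is_lim_seq_scal_l, is_lim_seq_geom. rewrite Rabs_pos_eq; lra.
Qed.

Lemma slope_phi2_periodic (z : Z) (x y : R) :
  slope phi2 (x + IZR z) (y + IZR z) = slope phi2 x y.
Proof.
  unfold slope. rewrite !phi2_add_IZR. f_equal. ring.
Qed.

Lemma slope_companion_S (m : nat) (x : R) :
  slope phi2 x (companion (S m) x) =
  ln x + slope_error x (companion (S m) x) - x * slope phi2 (alpha x) (companion m (alpha x)).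
Proof.
  unfold slope_error. cbn [companion]. rewrite Rinv_inv.
  assert (E : / x - alpha x = IZR (Int_part (/ x))) by (unfold alpha, frac_part; ring).
  rewrite <- (slope_phi2_periodic (Int_part (/ x)) (alpha x)), <- E.
  replace (alpha x + (/ x - alpha x)) with (/ x) by ring.
  rewrite (Rplus_comm (companion m (alpha x))). ring.
Qed.

(** The slope identity is iterated [m + 1] times; the last slope is taken between
    [alpha_{m+1}(x)] and the same point plus 1, so it is zero by periodicity. *)
Lemma slope_companion_sum (m : nat) :
  forall x, irrational_unit x ->
  slope phi2 x (companion (S m) x) =
  sum_n (fun k => (-1) ^ k * beta_pred k x *
           (ln (alpha_iter k x) +
            slope_error (alpha_iter k x) (companion (S m - k) (alpha_iter k x)))) m.
Proof.
  induction m as [|m IH]; intros x Hx; rewrite slope_companion_S.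
  - rewrite sum_O. cbn [alpha_iter beta_pred pow Nat.sub].
    replace (slope phi2 (alpha x) (companion 0 (alpha x))) with 0; [ring|].
    unfold slope. cbn [companion]. change 1 with (IZR 1). rewrite phi2_add_IZR.
    unfold Rminus, Rdiv. rewrite Rplus_opp_r. ring.
  - rewrite (IH _ (irrational_unit_alpha x Hx)).
    rewrite !sum_n_Reals, (decomp_sum _ (S m)) by lia. simpl pred.
    change (beta_pred 0 x) with 1. cbn [alpha_iter pow]. rewrite Nat.sub_0_r.
    unfold Rminus. rewrite Ropp_mult_distr_l, scal_sum.
    f_equal; [ring|]. apply sum_eq. intros k Hk.
    rewrite beta_pred_alpha, alpha_iter_alpha. cbn [alpha_iter pow].
    replace (S (S m) - S k)%nat with (S m - k)%nat by lia. ring.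
Qed.

(** * Differentiability implies convergence of the Wilton series *)

Lemma wilton_converges (x : R) :
  irrational_unit x -> ex_derive phi2 x ->
  ex_series (fun k => (-1) ^ k * gamma k x).
Proof.
  intros Hx [d Hd].
  destruct slope_error_control as [C HC].
  set (e := fun m k => (-1) ^ k * beta_pred k x *
     slope_error (alpha_iter k x) (companion (S m - k) (alpha_iter k x))).
  (* The finite sum of the errors, padded with zeros to a series so that
     dominated convergence applies. *)
  set (a := fun m k => if le_dec k m then e m k else 0).
  assert (Hit := fun k => irrational_unit_alpha_iter k x Hx).
  assert (Hsgn : forall k, Rabs ((-1) ^ k) = 1) by apply pow_1_abs.
  assert (L : exists l, is_lim_seq (fun m => Series (a m)) (Finite l)).
  { assert (Hl : forall k, is_lim_seq (fun m => a m k) (real (Lim_seq (fun m => a m k)))).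
    { intros k. apply Lim_seq_correct'. destruct (HC _ (proj1 (Hit k))) as [_ [l Hl]].
      exists ((-1) ^ k * beta_pred k x * l).
      apply (is_lim_seq_incr_n _ k).
      apply is_lim_seq_ext with (fun m => (-1) ^ k * beta_pred k x *
         slope_error (alpha_iter k x) (companion (S m) (alpha_iter k x))).
      + intros m. unfold a, e. destruct (le_dec k (m + k)); [|lia].
        now replace (S (m + k) - k)%nat with (S m) by lia.
      + apply (is_lim_seq_scal_l _ ((-1) ^ k * beta_pred k x) l), Hl.
        * intros m. destruct (companion_S_spec m _ (Hit k)) as (H1 & H2 & _). now split.
        * apply -> (is_lim_seq_incr_1 (fun m => companion m (alpha_iter k x))).
          apply companion_lim, Hit. }
    exists (Series (fun k => real (Lim_seq (fun m => a m k)))).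
    apply (tannery a _ (fun k => C * (4 / 3 * (3 / 4) ^ k))).
      + exact Hl.
      + intros m k. pose proof (beta_pred_bound k x Hx) as Hb.
        assert (HC0 : Rabs (slope_error (alpha_iter k x) (companion (S m) (alpha_iter k x))) <= C).
        { destruct (companion_S_spec m _ (Hit k)) as (H1 & H2 & H3).
          now apply (HC _ (proj1 (Hit k))). }
        assert (0 <= C) by (eapply Rle_trans; [apply Rabs_pos|exact HC0]).
        unfold a. destruct (le_dec k m) as [Hkm|_].
        * unfold e. rewrite !Rabs_mult, Hsgn, Rmult_1_l, Rmult_comm, (Rabs_pos_eq (beta_pred k x)) by lra.
          apply Rmult_le_compat; try apply Rabs_pos; try lra.
          replace (S m - k)%nat with (S (m - k)) by lia.
          destruct (companion_S_spec (m - k) _ (Hit k)) as (H1 & H2 & H3).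
          now apply (HC _ (proj1 (Hit k))).
        * rewrite Rabs_R0. apply Rmult_le_pos; lra.
      + apply ex_series_beta_pred_bound. }
  destruct L as [l Hl]. exists (l - d).
  apply (is_lim_seq_ext
    (fun m => Series (a m) - slope phi2 x (companion (S m) x))
    (sum_n (fun k => (-1) ^ k * gamma k x)) (l - d)).
  - intros m. rewrite (slope_companion_sum m x Hx).
    rewrite (Series_incr_n (a m) (S m)); [|lia|].
    + rewrite (Series_ext (fun k => a m (S m + k)%nat) (fun _ => 0 * 0)).
      * rewrite Series_scal_l, !sum_n_Reals. simpl pred. rewrite Rmult_0_l, Rplus_0_r.
        rewrite <- minus_sum. apply sum_eq. intros k Hk.
        unfold a, e. destruct (le_dec k m); [|lia]. unfold gamma.
        rewrite ln_Rinv by apply (Hit k). ring.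
      * intros k. unfold a. destruct (le_dec (S m + k) m); [lia|ring].
    + apply (ex_series_incr_n (a m) (S m)).
      apply (ex_series_ext (fun _ => 0)).
      * intros k. unfold a. destruct (le_dec (S m + k) m); [lia|reflexivity].
      * exists 0. apply (is_lim_seq_ext (fun _ => 0) (sum_n (fun _ : nat => 0)) 0).
        -- intros n. rewrite sum_n_const. ring.
        -- apply is_lim_seq_const.
  - apply is_lim_seq_minus'; [exact Hl|].
    apply slope_lim.
    + exact Hd.
    + intros m. apply (companion_S_spec m x Hx).
    + apply -> (is_lim_seq_incr_1 (fun m => companion m x)). now apply companion_lim.
Qed.

Theorem proposition25 (lambda : R) (hlambda : wilton_cremer lambda) :
  ~ ex_derive phi2 lambda.
Proof.
  destruct hlambda as [Hirr Hdiv]. intros Hd. apply Hdiv.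
  apply (wilton_converges (frac_part lambda)).
  - now apply irrational_frac_part.
  - apply (ex_derive_ext (fun t => phi2 (t + IZR (Int_part lambda)))).
    + intros t. apply phi2_add_IZR.
    + apply (ex_derive_comp phi2 (fun t => t + IZR (Int_part lambda))).
      * replace (frac_part lambda + IZR (Int_part lambda)) with lambda
          by (unfold frac_part; ring).
        exact Hd.
      * auto_derive. easy.
Qed.
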